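(* Let $\pi,\pi'\in S_n$ be distinct and let $i\in[2,n-2]$. If $d_i^R(\mathrm{rev}(\pi))=\mathrm{rev}(\pi')$, then $h_{i-1}(\pi)=\pi'$. If $d_i^R(\mathrm{flip}(\pi))=\mathrm{flip}(\pi')$, then $h_{n-i-1}(\pi)=\pi'$.
   Context: Permutations are in one-line notation. $\mathrm{ID}(\pi)$ is the set of $i\in[n-1]$ such that $i$ occurs to the right of $i+1$. $\mathrm{rev}(\pi)$ is $\pi$ read from right to left; $\mathrm{flip}(\pi)$ is obtained from $\mathrm{rev}(\pi)$ by replacing each value $v$ by $n+1-v$. $d_i$ acts on a permutation by: $\ldots i\ldots i-1\ldots i+1\ldots\leftrightarrow\ldots i+1\ldots i-1\ldots i\ldots$ and $\ldots i\ldots i+1\ldots i-1\ldots\leftrightarrow\ldots i-1\ldots i+1\ldots i\ldots$ (all else fixed), and as the identity if $i$ is between $i-1$ and $i+1$. For $i\in[2,n-2]$, $d_i^R(\pi)=\pi$ if $i+1\in\mathrm{ID}(\pi)\cap\mathrm{ID}(d_i(\pi))$, and $d_i^R(\pi)=d_i(\pi)$ otherwise. (Equivalently, $d_i^R$ acts on permutations through its action on the RSK insertion tableau, fixing the recording tableau.) Elementary shifted dual equivalences $h_i$, $1\le i\le n-3$: for $n=4$, $h_1$ swaps the values $x$ and $y$ when the permutation has one of the forms $$1x2y,\ x12y,\ 1x4y,\ x14y,\ 4x1y,\ x41y,\ 4x3y,\ x43y$$ (where $\{x,y\}$ are the two remaining values of $\{1,2,3,4\}$, in either order), and is the identity otherwise.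 For $n>4$, $h_i$ fixes all values outside $I=[i,i+3]$ and permutes the values in $I$ among their positions so that $\mathrm{fl}(h_i(\pi)|_I)=h_1(\mathrm{fl}(\pi|_I))$, where $\pi|_I$ is the subword of values in $I$ and $\mathrm{fl}$ replaces a word by the permutation in the same relative order. *)

(* Defs.v *)
From mathcomp Require Import all_boot all_fingroup.
Set Implicit Arguments.
Unset Strict Implicit.
Unset Printing Implicit Defensive.

(* 'I_n is {0, ..., n-1}, so values are shifted to write a permutation of     *)
(* {1, ..., n} in one-line notation as a word.                                *)
Definition oneline (n : nat) (s : 'S_n) : seq nat := [seq (s j).+1 | j : 'I_n].

Definition ID (w : seq nat) : pred nat :=
  [pred k | (1 <= k <= (size w).-1) && (index k.+1 w < index k w)].

(* The reversal rev is the one of seq.v. *)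
Definition flip (w : seq nat) : seq nat := [seq (size w).+1 - v | v <- rev w].

Definition between (w : seq nat) (a b c : nat) : bool :=
  (index a w < index b w < index c w) || (index c w < index b w < index a w).

Definition swap_values (a b : nat) (w : seq nat) : seq nat :=
  [seq [fun x => x with a |-> b, b |-> a] v | v <- w].

Definition dual_equiv (i : nat) (w : seq nat) : seq nat :=
  if between w i i.-1 i.+1 then swap_values i i.+1 w
  else if between w i i.+1 i.-1 then swap_values i i.-1 w
  else w.

Definition dual_equivR (i : nat) (w : seq nat) : seq nat :=
  if (i.+1 \in ID w) && (i.+1 \in ID (dual_equiv i w)) then w
  else dual_equiv i w.

(* On words of length 4 that are permutations of {1, 2, 3, 4}, the patterns    *)
(* below are mutually exclusive, so their order is irrelevant.                *)
Definition shifted_dual_equiv1 (w : seq nat) : seq nat :=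
  match w with
  | [:: 1; x; 2; y] => [:: 1; y; 2; x]
  | [:: x; 1; 2; y] => [:: y; 1; 2; x]
  | [:: 1; x; 4; y] => [:: 1; y; 4; x]
  | [:: x; 1; 4; y] => [:: y; 1; 4; x]
  | [:: 4; x; 1; y] => [:: 4; y; 1; x]
  | [:: x; 4; 1; y] => [:: y; 4; 1; x]
  | [:: 4; x; 3; y] => [:: 4; y; 3; x]
  | [:: x; 4; 3; y] => [:: y; 4; 3; x]
  | _ => w
  end.

Definition fl (w : seq nat) : seq nat :=
  [seq (count (fun y => y < x) w).+1 | x <- w].

Definition restrict (i : nat) (w : seq nat) : seq nat :=
  [seq v <- w | i <= v <= i + 3].

(* u is rearranged into the word u' such that                                 *)
(* fl u' = shifted_dual_equiv1 (fl u), and u' is then written in the          *)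
(* positions of u; the letter of u of relative rank k is the one of index     *)
(* k.-1 in the sorted word.                                                   *)
Definition shifted_dual_equiv (i : nat) (w : seq nat) : seq nat :=
  let u := restrict i w in
  let u' := [seq nth 0 (sort leq u) k.-1 | k <- shifted_dual_equiv1 (fl u)] in
  [seq (if i <= v <= i + 3 then nth 0 u' (index v u) else v) | v <- w].

(* Main.v *)
Require Import Defs.
From mathcomp Require Import all_boot all_fingroup zify.

Set Implicit Arguments.
Unset Strict Implicit.
Unset Printing Implicit Defensive.

(** Both operators only relabel letters with values in a window
    {a+1, ..., a+4}, and the relabelling depends only on the pattern (a
    permutation of {1, 2, 3, 4}) which these letters form. Reversing or flipping
    the word reverses or flips the pattern, so the statement reduces to a
    comparison of two relabellings for each of the 24 patterns. *)

(** * Patterns in a window, and relabellings of it *)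

Definition pattern (a : nat) (w : seq nat) : seq nat :=
  [seq v - a | v <- restrict a.+1 w].

Definition relabel (a : nat) (f : nat -> nat) (w : seq nat) : seq nat :=
  [seq (if a < v <= a.+1 + 3 then a + f (v - a) else v) | v <- w].

Definition dual_relabelling (i : nat) (w : seq nat) (v : nat) : nat :=
  if between w i i.-1 i.+1 then [fun x => x with i |-> i.+1, i.+1 |-> i] v
  else if between w i i.+1 i.-1 then [fun x => x with i |-> i.-1, i.-1 |-> i] v
  else v.

Definition dual_relabellingR (i : nat) (w : seq nat) : nat -> nat :=
  if (i.+1 \in ID w) && (i.+1 \in ID (dual_equiv i w)) then id
  else dual_relabelling i w.

(** The action of [shifted_dual_equiv1] on the positions of [s], turned into a map on its
    letters. *)
Definition shifted_dual_relabelling (s : seq nat) : nat -> nat :=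
  fun x => nth 0 (shifted_dual_equiv1 s) (index x s).

Lemma restrict_pattern a w : restrict a.+1 w = [seq a + x | x <- pattern a w].
Proof.
rewrite -map_comp -[LHS]map_id; apply/eq_in_map => v.
by rewrite mem_filter /= => /andP[/andP[av _] _]; rewrite subnKC // ltnW.
Qed.

(** Only letters other than [x] and [y] can be deleted, so whichever of the two comes first stays
    first. An absent letter has the size of the word as index on both sides. *)
Lemma ltn_index_filter (T : eqType) (P : pred T) x y (w : seq T) :
  P x -> P y ->
  (index x [seq v <- w | P v] < index y [seq v <- w | P v])
    = (index x w < index y w).
Proof.
move=> Px Py; elim: w => //= v w IHw; case Pv: (P v) => /=.
  by do 2 case: eqP => // _.
have [vx|_] := eqVneq v x; first by rewrite vx Px in Pv.
by have [vy|_] := eqVneq v y; first by rewrite vy Py in Pv.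
Qed.

Lemma ltn_index_pattern a w x y : 0 < x <= 4 -> 0 < y <= 4 ->
  (index (a + x) w < index (a + y) w)
    = (index x (pattern a w) < index y (pattern a w)).
Proof.
move=> x4 y4.
rewrite -(@ltn_index_filter _ (fun v => a.+1 <= v <= a.+1 + 3)); [|lia|lia].
by rewrite -/(restrict a.+1 w) restrict_pattern !index_map //; exact: addnI.
Qed.

Lemma between_pattern a w x y z :
  0 < x <= 4 -> 0 < y <= 4 -> 0 < z <= 4 ->
  between w (a + x) (a + y) (a + z) = between (pattern a w) x y z.
Proof. by move=> x4 y4 z4; rewrite /between !ltn_index_pattern. Qed.

Lemma eq_in_relabel a f g w :
  {in iota 1 4, f =1 g} -> relabel a f w = relabel a g w.
Proof.
move=> fg; apply/eq_map => v; case: ifP => // av.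
by rewrite fg // mem_iota; lia.
Qed.

Lemma relabel_id a f w : {in iota 1 4, f =1 id} -> relabel a f w = w.
Proof.
move=> /eq_in_relabel->; rewrite -[RHS]map_id; apply/eq_map => v /=.
by case: ifP => // av; lia.
Qed.

(** Since [f] keeps the window stable, the same positions survive the restriction before and after
    relabelling. *)
Lemma pattern_relabel a f w : {in iota 1 4, forall x, f x \in iota 1 4} ->
  pattern a (relabel a f w) = map f (pattern a w).
Proof.
move=> f4; rewrite /pattern /restrict /relabel; elim: w => //= v w IHw.
case: (boolP (a < v <= a.+1 + 3)) => av; last by rewrite (negbTE av).
have /f4 : v - a \in iota 1 4 by rewrite mem_iota; lia.
rewrite mem_iota => fv; rewrite ifT /=; last by lia.
by rewrite IHw addKn.
Qed.

(** * Dual equivalences as relabellings *)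

Lemma dual_equivE i w : dual_equiv i w = map (dual_relabelling i w) w.
Proof.
rewrite /dual_equiv /dual_relabelling.
by case: ifP => // _; case: ifP => // _; rewrite map_id.
Qed.

Lemma dual_equiv_relabel a w :
  dual_equiv a.+2 w = relabel a (dual_relabelling 2 (pattern a w)) w.
Proof.
(* With $i = a+2$, the values $i-1$, $i$, $i+1$ are the letters 1, 2, 3 of the pattern. *)
rewrite dual_equivE /dual_relabelling -!(between_pattern a w) // !addn1 addn2 addn3.
apply/eq_map => v; case: ifP => _ /=; last case: ifP => _ /=;
  repeat case: eqP; case: ifP; lia.
Qed.

Lemma dual_relabelling_iota s :
  {in iota 1 4, forall x, dual_relabelling 2 s x \in iota 1 4}.
Proof.
move=> x; rewrite /dual_relabelling.
by case: ifP => _; last case: ifP => _; move: x; apply/allP.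
Qed.

Lemma pattern_dual_equiv a w :
  pattern a (dual_equiv a.+2 w) = dual_equiv 2 (pattern a w).
Proof.
rewrite dual_equiv_relabel pattern_relabel ?dual_equivE //.
exact: dual_relabelling_iota.
Qed.

Lemma perm_pattern n a w : perm_eq w (iota 1 n) -> a + 4 <= n ->
  perm_eq (pattern a w) (iota 1 4).
Proof.
move=> wP an; have -> : iota 1 4 = [seq v - a | v <- iota a.+1 4].
  by rewrite -[a.+1]addn1 iotaDl -map_comp map_id_in // => x _ /=; rewrite addKn.
apply/perm_map/uniq_perm; rewrite ?filter_uniq ?(perm_uniq wP) ?iota_uniq //.
move=> v; rewrite mem_filter (perm_mem wP) !mem_iota; lia.
Qed.

(** Membership of $i+1 = a+3$ compares it with $a+4$; this is why the window has four values
    although $d_i$ itself involves only three. The size hypotheses make the range conditions of [ID]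
    true on both sides. *)
Lemma ID_pattern a w : a + 4 <= size w -> size (pattern a w) = 4 ->
  (a.+3 \in ID w) = (3 \in ID (pattern a w)).
Proof.
move=> aw s4; rewrite !inE s4 -ltn_index_pattern // addn3 addn4.
by congr (_ && _); lia.
Qed.

Lemma size_dual_equiv i w : size (dual_equiv i w) = size w.
Proof. by rewrite dual_equivE size_map. Qed.

Lemma dual_equivR_relabel n a w : perm_eq w (iota 1 n) -> a + 4 <= n ->
  dual_equivR a.+2 w = relabel a (dual_relabellingR 2 (pattern a w)) w.
Proof.
move=> wP an; have s4 := perm_size (perm_pattern wP an).
have aw : a + 4 <= size w by rewrite (perm_size wP) size_iota.
rewrite /dual_equivR /dual_relabellingR (ID_pattern aw s4).
rewrite (@ID_pattern a (dual_equiv a.+2 w)) ?pattern_dual_equiv ?size_dual_equiv //.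
by case: ifP => _; [rewrite relabel_id | exact: dual_equiv_relabel].
Qed.

(** * Shifted dual equivalences as relabellings *)

Lemma fl_shift a s : fl [seq a + x | x <- s] = fl s.
Proof.
rewrite /fl -map_comp; apply/eq_map => x /=; rewrite count_map.
by congr _.+1; apply/eq_count => y /=; rewrite ltn_add2l.
Qed.

Lemma shifted_dual_equiv1_perm s : perm_eq s (iota 1 4) ->
  (fl s == s) && perm_eq (shifted_dual_equiv1 s) (iota 1 4).
Proof.
(* Membership in the explicit list of the 24 permutations makes the claim decidable by
   computation. *)
by rewrite -mem_permutations; apply/allP: s; vm_compute.
Qed.

Lemma shifted_dual_equiv_relabel n a w : perm_eq w (iota 1 n) -> a + 4 <= n ->
  shifted_dual_equiv a.+1 w
    = relabel a (shifted_dual_relabelling (pattern a w)) w.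
Proof.
move=> wP an; rewrite /shifted_dual_equiv restrict_pattern fl_shift.
have sP := perm_pattern wP an; set s := pattern a w in sP *.
have /andP[/eqP-> hP] := shifted_dual_equiv1_perm sP.
(* The sorted window is $a+1, \ldots, a+4$, so its letter of rank $k$ is $a+k$. *)
have -> : sort leq [seq a + x | x <- s] = [seq a + x | x <- iota 1 4].
  apply: (sorted_eq leq_trans anti_leq) (sort_sorted leq_total _) _ _.
    by rewrite /= !leq_add2l.
  by rewrite perm_sort perm_map.
have -> : [seq nth 0 [seq a + x | x <- iota 1 4] k.-1 | k <- shifted_dual_equiv1 s]
    = [seq a + x | x <- shifted_dual_equiv1 s].
  apply/eq_in_map => k; rewrite (perm_mem hP) mem_iota => k4.
  by rewrite (nth_map 0) ?nth_iota ?size_iota; lia.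
apply/eq_map => v; case: ifP => // av.
have vE : v = a + (v - a) by lia.
rewrite [in index v _]vE index_map; last exact: addnI.
have xs : v - a \in s by rewrite (perm_mem sP) mem_iota; lia.
(* The default 0 is never read: [v - a] occurs in [s], which is as long as its image. *)
by rewrite (nth_map 0) // (perm_size hP) -(perm_size sP) index_mem.
Qed.

(** * Reversal and flip of patterns and relabellings *)

Lemma rev_relabel a f w : rev (relabel a f w) = relabel a f (rev w).
Proof. by rewrite /relabel map_rev. Qed.

Lemma rev_pattern a w : pattern a (rev w) = rev (pattern a w).
Proof. by rewrite /pattern /restrict filter_rev map_rev. Qed.

Lemma flip_flip n w : perm_eq w (iota 1 n) -> flip (flip w) = w.
Proof.
move=> wP; rewrite /flip -map_rev revK -map_comp size_map size_rev.
rewrite map_id_in // => v /=; rewrite (perm_mem wP) (perm_size wP) size_iota.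
by rewrite mem_iota; lia.
Qed.

Lemma perm_flip n w : perm_eq w (iota 1 n) -> perm_eq (flip w) (iota 1 n).
Proof.
move=> wP; have wv v : v \in w -> 0 < v <= n.
  by rewrite (perm_mem wP) mem_iota.
apply: uniq_perm (iota_uniq _ _) _ => [|v]; rewrite /flip (perm_size wP) size_iota.
  rewrite map_inj_in_uniq ?rev_uniq ?(perm_uniq wP) ?iota_uniq // => x y.
  by rewrite !mem_rev => /wv ? /wv ?; lia.
apply/mapP/idP => [[x] | ].
  by rewrite mem_rev mem_iota => /wv ? ->; lia.
rewrite mem_iota => v4; exists (n.+1 - v); last by lia.
by rewrite mem_rev (perm_mem wP) mem_iota; lia.
Qed.

(** The complement $v \mapsto n+1-v$ carries the window $a+1, \ldots, a+4$ to the one with offset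
    $n-a-4$, where it acts on patterns as $x \mapsto 5-x$. *)
Lemma pattern_flip n a w : perm_eq w (iota 1 n) -> a + 4 <= n ->
  pattern (n - a - 4) (flip w) = flip (pattern a w).
Proof.
move=> wP an; rewrite /flip (perm_size wP) (perm_size (perm_pattern wP an)).
rewrite !size_iota -rev_pattern /pattern /restrict filter_map -!map_comp.
have wv v : v \in rev w -> 0 < v <= n.
  by rewrite mem_rev (perm_mem wP) mem_iota.
rewrite (@eq_in_filter _ _ (fun v => a < v <= a.+1 + 3)); last first.
  by move=> v /wv ? /=; lia.
by apply/eq_in_map => v; rewrite mem_filter => /andP[? /wv ?] /=; lia.
Qed.

(** The relabelling is conjugated by the complement $x \mapsto 5-x$ of the window; stability under
    [f] keeps the subtractions from truncating. *)
Lemma flip_relabel n a f w : perm_eq w (iota 1 n) -> a + 4 <= n ->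
  {in iota 1 4, forall x, f x \in iota 1 4} ->
  flip (relabel a f w)
    = relabel (n - a - 4) (fun x => 5 - f (5 - x)) (flip w).
Proof.
move=> wP an f4; rewrite /flip rev_relabel size_map (perm_size wP) size_iota.
rewrite /relabel -!map_comp; apply/eq_in_map => v.
rewrite mem_rev (perm_mem wP) mem_iota => vn /=.
case: ifP => av; case: ifP => bv; try lia.
have /f4 : v - a \in iota 1 4 by rewrite mem_iota; lia.
rewrite mem_iota; have -> : 5 - (n.+1 - v - (n - a - 4)) = v - a by lia.
lia.
Qed.

Lemma dual_relabellingR_iota s :
  {in iota 1 4, forall x, dual_relabellingR 2 s x \in iota 1 4}.
Proof.
by move=> x; rewrite /dual_relabellingR; case: ifP => // _ /dual_relabelling_iota.
Qed.

(** * Comparison of the relabellings on the 24 patterns *)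

Lemma dual_relabellingR_rev s : perm_eq s (iota 1 4) ->
  {in iota 1 4, dual_relabellingR 2 (rev s) =1 id} \/
  {in iota 1 4, dual_relabellingR 2 (rev s) =1 shifted_dual_relabelling s}.
Proof.
(* A boolean form of the disjunction, so that all 24 patterns can be checked by evaluation. *)
move=> sP; have : all (fun x => dual_relabellingR 2 (rev s) x == x) (iota 1 4)
    || all (fun x => dual_relabellingR 2 (rev s) x
                       == shifted_dual_relabelling s x) (iota 1 4).
  by rewrite -mem_permutations in sP; apply/allP: s sP; vm_compute.
by case/orP => /allP sE; [left | right] => x /sE/eqP.
Qed.

(** The conjugate by $x \mapsto 5-x$ is the map that [flip_relabel] produces when a flip is
    undone. *)
Lemma dual_relabellingR_flip s : perm_eq s (iota 1 4) ->
  {in iota 1 4, (fun x => 5 - dual_relabellingR 2 (flip s) (5 - x)) =1 id} \/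
  {in iota 1 4, (fun x => 5 - dual_relabellingR 2 (flip s) (5 - x))
                  =1 shifted_dual_relabelling s}.
Proof.
move=> sP; have : all (fun x => 5 - dual_relabellingR 2 (flip s) (5 - x) == x)
                      (iota 1 4)
    || all (fun x => 5 - dual_relabellingR 2 (flip s) (5 - x)
                       == shifted_dual_relabelling s x) (iota 1 4).
  by rewrite -mem_permutations in sP; apply/allP: s sP; vm_compute.
by case/orP => /allP sE; [left | right] => x /sE/eqP.
Qed.

(** * One-line words and the conclusion *)

Lemma oneline_perm n (s : 'S_n) : perm_eq (oneline s) (iota 1 n).
Proof.
rewrite /oneline; apply: uniq_perm (iota_uniq _ _) _ => [|v].
  by rewrite map_inj_uniq ?enum_uniq // => x y [] /val_inj/perm_inj.
apply/mapP/idP => [[j _ ->] | ]; first by rewrite mem_iota add1n !ltnS ltn_ord.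
case: v => [|v]; rewrite mem_iota // add1n !ltnS /= => vn.
by exists ((s^-1)%g (Ordinal vn)); rewrite ?mem_enum // permKV.
Qed.

Lemma oneline_inj n : injective (@oneline n).
Proof.
move=> s t /eq_in_map st; apply/permP => j.
by have /st[/val_inj] : j \in enum 'I_n by rewrite mem_enum.
Qed.

Theorem proposition4p4 (n : nat) (pi pi' : 'S_n) (i : nat) :
  pi <> pi' ->
  2 <= i <= n - 2 ->
  (dual_equivR i (rev (oneline pi)) = rev (oneline pi') ->
     shifted_dual_equiv i.-1 (oneline pi) = oneline pi') /\
  (dual_equivR i (flip (oneline pi)) = flip (oneline pi') ->
     shifted_dual_equiv (n - i - 1) (oneline pi) = oneline pi').
Proof.
move=> neq_pi; have {neq_pi} : oneline pi <> oneline pi' by move=> /oneline_inj.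
move: (oneline_perm pi) (oneline_perm pi').
move: (oneline pi) (oneline pi') => w w' wP wP' neq_w.
(* Writing $i = a+2$ makes $a+1 = i-1$ the first value of the window. *)
case: i => [|[|a]] // /andP[_ an]; have {}an : a + 4 <= n by lia.
have rwP : perm_eq (rev w) (iota 1 n) by rewrite perm_rev.
split.
  rewrite (dual_equivR_relabel rwP an) rev_pattern => /(congr1 rev).
  rewrite rev_relabel !revK (shifted_dual_equiv_relabel wP an).
  have [sE | sE <-] := dual_relabellingR_rev (perm_pattern wP an).
    (* A trivial relabelling would give [w = w'], against distinctness. *)
    by rewrite relabel_id.
  by apply: eq_in_relabel => x /sE.
(* The window of [flip w] at offset [a] comes from the window of [w] at offset [b], whose first
   value is $b+1 = n-i-1$. *)
have {rwP} fwP := perm_flip wP; pose b := n - a - 4.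
have bn : b + 4 <= n by lia.
have aE : a = n - b - 4 by lia.
have -> : n - a.+2 - 1 = b.+1 by lia.
rewrite (dual_equivR_relabel fwP an) [in pattern _ _]aE (pattern_flip wP bn).
move=> /(congr1 flip); rewrite (flip_relabel fwP an) //; last first.
  exact: dual_relabellingR_iota.
rewrite (flip_flip wP) (flip_flip wP') (shifted_dual_equiv_relabel wP bn).
have [sE | sE <-] := dual_relabellingR_flip (perm_pattern wP bn).
  by rewrite relabel_id.
by apply: eq_in_relabel => x /sE.
Qed.
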